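(* Let $k\ge 1$ be an integer and let $\mathcal{H}_k=\{0,h_2,\ldots,h_k\}$, where $0<h_2<\cdots<h_k$ are integers ($\mathcal{H}_1=\{0\}$); $\mathcal{H}_k$ is not necessarily admissible. Write $h_1=0$. Let $\mathfrak{P}_k$ be the set of prime $k$-tuples $\mathfrak{p}_k=(p,p+h_2,\ldots,p+h_k)$ associated with $\mathcal{H}_k$. Then the number $\pi_{(k)}(x):=\sum^{x}_{\mathfrak{p}_k\in\mathfrak{P}_k}1$ of prime $k$-tuples up to a cut-off integer $x\ge p+h_k$ (that is, the number of $\mathfrak{p}_k\in\mathfrak{P}_k$ with $p+h_k\le x$) is given by $$\pi_{(k)}(x)=(-1)^k\sum_{n=2}^{x}\mu(n)\cdots\mu(n+h_k)\,\frac{\Lambda(n)}{\log(n)}\cdots\frac{\Lambda(n+h_k)}{\log(n+h_k)},$$ where the products run over $n+h_j$ for $j=1,\ldots,k$. In particular, for every positive integer $i$ with $2i\le x-2$, the number of prime doubles $(p,p+2i)$ up to the cut-off $x\ge p+2i$ is $$\pi_{(2)}(x):=\sum^{x}_{\mathfrak{p}_2\in\mathfrak{P}_2}1=\sum_{n=2}^{x}\mu(n)\mu(n+2i)\,\frac{\Lambda(n)}{\log(n)}\,\frac{\Lambda(n+2i)}{\log(n+2i)},$$ with twin primes corresponding to $i=1$.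
   Context: $\mu$ is the Möbius function, $\Lambda$ is the von Mangoldt function ($\Lambda(n)=\log q$ if $n=q^\nu$ with $q$ prime and $\nu\ge1$, and $\Lambda(n)=0$ otherwise), and $\log$ is the natural logarithm. A prime $k$-tuple associated with $\mathcal{H}_k=\{0,h_2,\ldots,h_k\}$ is a tuple $(p,p+h_2,\ldots,p+h_k)$ all of whose entries are prime; for $k=1$ it is just a prime $p$. A prime double is a prime $2$-tuple, here with $\mathcal{H}_2=\{0,2i\}$. The symbol $\sum^{x}_{\mathfrak{p}_k\in\mathfrak{P}_k}$ denotes the sum over the prime $k$-tuples associated with $\mathcal{H}_k$ up to the cut-off $x\ge p+h_k$. Admissible means that for every prime $q$ the elements of $\mathcal{H}_k$ do not cover all residue classes modulo $q$.
   Formalization: The sums over n are restricted to those n with n + h_k ≤ x (n + 2i ≤ x for prime doubles); as printed, with n up to x, the formula fails, e.g. for {0,2} and x = 4, where the count is 0 but the term n = 3 contributes 1. *)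

(* Defs.v *)
From mathcomp Require Import all_boot all_order all_algebra.
From mathcomp Require Import all_classical all_reals all_analysis.

Set Implicit Arguments.
Unset Strict Implicit.
Unset Printing Implicit Defensive.

Import GRing.Theory.

Local Open Scope classical_set_scope.
Local Open Scope ring_scope.

(* The guard on n is needed because primes 0 = [::]; the value at 0 is junk. *)
Definition mobius (n : nat) : int :=
  if (0 < n)%N && all (fun q => logn q n == 1%N) (primes n)
  then (-1) ^+ size (primes n) else 0.

(* If n = q ^ v with q prime and v > 0 then q <= n and v <= n, so the bounded
   ranges lose nothing; the prime q is unique. *)
Definition vonMangoldt (R : realType) (n : nat) : R :=
  if [pick q : 'I_n.+1 | prime q &&
        [exists v : 'I_n.+1, (0 < v)%N && (n == q ^ v)%N]] is Some q
  then ln (q%:R) else 0.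

(* The tuple h lists the elements 0 = h_1 < h_2 < ... < h_k of H_k. *)
Definition prime_tuples (k : nat) (h : k.-tuple nat) : set (k.-tuple nat) :=
  [set t | all prime t /\ exists p : nat, t = [tuple of map (addn p) h]].

(* The last entry of the tuple associated with p is p + h_k. The summation set
   is finite when 0 < k, so the finitely supported sum is the actual sum. *)
Definition prime_tuple_sum (V : nmodType) (k : nat) (h : k.-tuple nat)
    (x : nat) (f : k.-tuple nat -> V) : V :=
  \sum_(t \in [set t | prime_tuples h t /\ (last 0%N t <= x)%N]) f t.

Definition prime_tuple_count (k : nat) (h : k.-tuple nat) (x : nat) : nat :=
  prime_tuple_sum h x (fun=> 1%N).

(* Main.v *)
Require Import Defs.
From mathcomp Require Import all_boot all_order all_algebra.
From mathcomp Require Import all_classical all_reals all_analysis.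

Set Implicit Arguments.
Unset Strict Implicit.
Unset Printing Implicit Defensive.

Import Order.TTheory GRing.Theory Num.Theory.

Local Open Scope ring_scope.

(** For n >= 2, the weight mobius n * Lambda(n) / log n equals -1 if n is prime
    and 0 otherwise: Lambda(n) vanishes unless n is a prime power q ^ v, the
    Moebius function vanishes on q ^ v as soon as v > 1, and at a prime q the
    factors are -1 and log q / log q = 1 (lemma [mobius_vonMangoldt]).

    Taking the product over the shifts n + h_j, the summand of the formula is
    (-1) ^ k times the indicator that all the n + h_j are prime, so the outer
    sign cancels and the sum counts the n for which the shifts of n form a prime
    tuple (lemma [prod_mobius_vonMangoldt]). Since h_1 = 0, a prime tuple
    determines its base point n, which is itself prime and hence lies in
    [2, x]; prime tuples up to x are therefore in bijection with these n (lemma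
    [prime_tuple_sumE]). The statement on prime doubles is the case k = 2. *)

Lemma mobius_prime (p : nat) : prime p -> mobius p = -1.
Proof.
move=> pp; rewrite /mobius prime_gt0 // primes_prime //= lognE pp prime_gt0 //.
by rewrite dvdnn divnn prime_gt0 //= logn1 expr1.
Qed.

Lemma mobius_prime_power (q v : nat) :
  prime q -> (1 < v)%N -> mobius (q ^ v) = 0.
Proof.
move=> pq v1; rewrite /mobius primesX ?(ltnW v1) // primes_prime //= pfactorK //.
by rewrite gtn_eqF // !andbF.
Qed.

Lemma vonMangoldt_prime (R : realType) (p : nat) :
  prime p -> vonMangoldt R p = ln (p%:R).
Proof.
move=> pp; rewrite /vonMangoldt; case: pickP => [[q q_lt] | /(_ ord_max)].
  case/andP=> /= pq /existsP[[v v_lt] /= /andP[v0 /eqP pE]].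
  rewrite {q_lt v_lt}pE in pp *.
  (* q divides the prime q ^ v, hence q = q ^ v. *)
  have /eqP -> : v == 1%N; last by rewrite expn1.
  rewrite eqn_leq v0 andbT leqNgt; apply: contraL pp => v1.
  apply/negP => /primeP[_ /(_ q)]; rewrite dvdn_exp // => /(_ isT).
  rewrite (gtn_eqF (prime_gt1 pq)) -{1}(expn1 q) eqn_exp2l ?prime_gt1 //.
  by rewrite ltn_eqF.
rewrite /= pp /= => /negbT /existsP[].
by exists (inord 1); rewrite inordK ?ltnS ?prime_gt0 //= expn1 eqxx.
Qed.

(** The Moebius factor removes the proper prime powers from the support of the
    von Mangoldt function, and the logarithm normalizes what remains. *)
Lemma mobius_vonMangoldt (R : realType) (n : nat) : (1 < n)%N ->
  (mobius n)%:~R * (vonMangoldt R n / ln (n%:R : R)) = - (prime n)%:R.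
Proof.
move=> n1; have [pn|npn] := boolP (prime n).
  rewrite mobius_prime // vonMangoldt_prime // divff ?mulr1 //.
  by rewrite gt_eqF // ln_gt0 // ltr1n.
rewrite oppr0 /vonMangoldt; case: pickP => [[q q_lt]|_]; last by rewrite mul0r mulr0.
case/andP=> /= pq /existsP[[v v_lt] /= /andP[v0 /eqP nE]].
rewrite {1}nE mobius_prime_power ?mul0r // ltn_neqAle v0 andbT.
by apply: contra npn => /eqP v1; rewrite nE -v1 expn1.
Qed.

Lemma prod_mobius_vonMangoldt (R : realType) (k : nat) (h : k.-tuple nat)
    (n : nat) : (1 < n)%N ->
  (\prod_(j < k) (mobius (n + tnth h j))%:~R) *
    \prod_(j < k) (vonMangoldt R (n + tnth h j) /
                   ln ((n + tnth h j)%:R : R)) =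
  (-1) ^+ k * (all prime (map (addn n) h))%:R.
Proof.
move=> n1; rewrite -big_split /=.
under eq_bigr => j _ do
  rewrite mobius_vonMangoldt ?(leq_trans n1) ?leq_addr // -mulN1r.
rewrite big_split /= prodr_const card_ord; congr (_ * _).
rewrite -(big_tuple _ _ h xpredT (fun m => (prime (n + m))%:R)) /=.
elim: (tval h) => [|a s IHs]; first by rewrite big_nil.
by rewrite big_cons IHs -natrM mulnb.
Qed.

(** Because h_1 = 0, the base point of a tuple is its first entry: it is
    recovered from the tuple, and it is at least 2 when the tuple is prime. *)
Lemma prime_tuple_sumE (V : nmodType) (k : nat) (h : k.-tuple nat) (x : nat)
    (f : k.-tuple nat -> V) : (0 < k)%N -> nth 0%N h 0 = 0%N ->
  prime_tuple_sum h x f =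
  \sum_(2 <= n < x.+1 | (n + last 0%N h <= x)%N && all prime (map (addn n) h))
    f [tuple of map (addn n) h].
Proof.
move=> k0 h0; pose shift n := [tuple of map (addn n) h].
have nth_shift n : nth 0%N (shift n) 0 = n.
  by rewrite (nth_map 0%N) ?size_tuple // h0 addn0.
have last_shift n : last 0%N (shift n) = (n + last 0%N h)%N.
  rewrite -!nth_last !size_tuple (nth_map 0%N) //.
  by rewrite size_tuple prednK.
pose P n := (n + last 0 h <= x)%N && all prime (map (addn n) h).
pose r := map shift [seq n <- index_iota 2 x.+1 | P n].
have r_uniq : uniq r.
  rewrite map_inj_uniq ?filter_uniq ?iota_uniq // => m n mn.
  by rewrite -(nth_shift m) mn nth_shift.
rewrite -(big_filter _ P) -(big_map shift xpredT f) -/r.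
rewrite (fsbig_seq _ _ r_uniq) /prime_tuple_sum.
apply: eq_fsbigl; apply/seteqP; split => t /=.
  move=> [[+ [p tE]]]; have {tE}-> : t = shift p by apply: val_inj.
  rewrite last_shift => t_prime t_le.
  have pp : prime p.
    by rewrite -(nth_shift p); apply: (all_nthP 0%N t_prime); rewrite size_tuple.
  apply: map_f; rewrite mem_filter /P t_le t_prime mem_index_iota prime_gt1 //=.
  by rewrite ltnS (leq_trans (leq_addr _ _) t_le).
case/mapP=> n; rewrite mem_filter => /andP[/andP[n_le n_prime] _] ->.
by rewrite last_shift; split=> //; split=> //; exists n.
Qed.

Lemma prime_tuple_countE (R : realType) (k : nat) (h : k.-tuple nat)
    (x : nat) : (0 < k)%N -> nth 0%N h 0 = 0%N ->
  (prime_tuple_count h x)%:R =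
    (-1) ^+ k *
    \sum_(2 <= n < x.+1 | (n + last 0 h <= x)%N)
      ((\prod_(j < k) (mobius (n + tnth h j))%:~R) *
       \prod_(j < k) (vonMangoldt R (n + tnth h j) /
                      ln ((n + tnth h j)%:R : R))).
Proof.
move=> k0 h0; rewrite /prime_tuple_count prime_tuple_sumE // natr_sum.
rewrite mulr_sumr big_mkcondr big_nat_cond [RHS]big_nat_cond.
apply: eq_bigr => n /andP[/andP[n1 _] _].
rewrite prod_mobius_vonMangoldt // mulrA -expr2 sqrr_sign mul1r.
by case: all.
Qed.

Theorem proposition2p1 (R : realType) :
  (forall (k : nat) (h : k.-tuple nat) (x : nat),
     (0 < k)%N -> nth 0%N h 0 = 0%N -> sorted ltn h ->
     (prime_tuple_count h x)%:R =
       (-1) ^+ k *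
       \sum_(2 <= n < x.+1 | (n + last 0 h <= x)%N)
         ((\prod_(j < k) (mobius (n + tnth h j))%:~R) *
          \prod_(j < k) (vonMangoldt R (n + tnth h j) /
                         ln ((n + tnth h j)%:R : R))))
  /\
  (forall i x : nat,
     (0 < i)%N -> (2 * i <= x - 2)%N ->
     (prime_tuple_count [tuple 0%N; (2 * i)%N] x)%:R =
       \sum_(2 <= n < x.+1 | (n + 2 * i <= x)%N)
         ((mobius n)%:~R * (mobius (n + 2 * i))%:~R *
          (vonMangoldt R n / ln (n%:R : R)) *
          (vonMangoldt R (n + 2 * i) / ln ((n + 2 * i)%:R : R)))).
Proof.
split=> [k h x k0 h0 _|i x _ _]; first exact: prime_tuple_countE.
rewrite prime_tuple_countE //= sqrrN expr1n mul1r; apply: eq_bigr => n _.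
by rewrite !big_ord_recl !big_ord0 !mulr1 /= !(tnth_nth 0%N) /= addn0 !mulrA.
Qed.
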